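(* Let $G$ be a connected graph with adjacency matrix $A$, $d=A\mathbf 1$, $D=\mathrm{diag}(d)$, let $e=(i,j)$, $i\ne j$, $a_{ij}>0$, be an edge that is not a cut-edge, and $v=e_i-e_j$. For $t\in[0,1]$ let $A(t)=A+ta_{ij}vv^T$ (so $A(t)\mathbf 1=d$), $P(t)=D^{-1}A(t)$ (irreducible stochastic) and $f(t)=K(P(t))$. Let $1=\lambda_1,\lambda_2,\dots,\lambda_n$ be the eigenvalues of $P(0)=D^{-1}A$. Then the (right) derivative $f'(0)$ exists and \[ 0\le f'(0)\le a_{ij}\big(d_i^{-1}+d_j^{-1}\big)\sum_{\ell=2}^n\frac{1}{(1-\lambda_\ell)^2}. \]
   Context: Graphs are undirected and possibly weighted on vertex set $\{1,\dots,n\}$, with symmetric nonnegative adjacency matrix $A=(a_{k\ell})$; $d=A\mathbf 1$ (all entries assumed positive); $e_k$ is the $k$-th column of the identity and $\mathbf 1$ the all-ones vector. For an irreducible row-stochastic matrix $Q$ with stationary vector $\pi$, the Kemeny constant is $K(Q)=\sum_j\pi_j m_{kj}$, where $m_{kj}$ is the expected first passage time from $k$ to $j$ ($m_{kk}=0$), independent of $k$; equivalently $K(Q)=\sum_{\ell=2}^n 1/(1-\lambda_\ell)$, where $1=\lambda_1,\lambda_2,\dots,\lambda_n$ are the eigenvalues of $Q$. The edge $e$ is a cut-edge if the graph obtained by deleting $e$ is disconnected. *)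

(* Defs.v *)
From HB Require Import structures.
From mathcomp Require Import all_boot all_order all_algebra.
From mathcomp Require Import all_classical all_reals all_analysis.
Set Implicit Arguments. Unset Strict Implicit. Unset Printing Implicit Defensive.
Import Order.TTheory GRing.Theory Num.Theory.
Local Open Scope ring_scope.

Section Defs.
Variables (R : realType) (n : nat).

Definition adj (A : 'M[R]_n) : rel 'I_n := fun k l => 0 < A k l.

Definition connected_graph (A : 'M[R]_n) : Prop :=
  forall k l : 'I_n, connect (adj A) k l.

Definition adj_del (A : 'M[R]_n) (i j : 'I_n) : rel 'I_n :=
  fun k l => (0 < A k l) && ~~ (((k == i) && (l == j)) || ((k == j) && (l == i))).

Definition is_cut_edge (A : 'M[R]_n) (i j : 'I_n) : Prop :=
  ~ (forall k l : 'I_n, connect (adj_del A i j) k l).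

Definition stochastic (Q : 'M[R]_n) : Prop :=
  (forall k l, 0 <= Q k l) /\ forall k, \sum_l Q k l = 1.

Definition stationary (Q : 'M[R]_n) (pi : 'rV[R]_n) : Prop :=
  pi *m Q = pi /\ (forall k, 0 <= pi 0 k) /\ \sum_k pi 0 k = 1.

Definition stat_vec (Q : 'M[R]_n) : 'rV[R]_n :=
  xget 0 [set pi | stationary Q pi].

Definition taboo (Q : 'M[R]_n) (j : 'I_n) : 'M[R]_n :=
  \matrix_(k, l) (if l == j then 0 else Q k l).

(* expected first passage time from k to j (m_kk = 0): for k <> j,
   m_kj is the k-th entry of the solution of m = 1 + Q_taboo m,
   i.e. m_kj = 1 + sum_{l <> j} q_kl m_lj. *)
Definition mfpt (Q : 'M[R]_n) (k j : 'I_n) : R :=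
  if k == j then 0
  else (invmx (1%:M - taboo Q j) *m (const_mx 1 : 'cV[R]_n)) k 0.

(* Kemeny constant K(Q) = sum_j pi_j m_{k0 j} (independent of k0 for
   irreducible Q) *)
Definition kemeny (k0 : 'I_n) (Q : 'M[R]_n) : R :=
  \sum_j stat_vec Q 0 j * mfpt Q k0 j.

Definition degs (A : 'M[R]_n) : 'cV[R]_n := A *m (const_mx 1 : 'cV[R]_n).

Definition evec (i j : 'I_n) : 'cV[R]_n :=
  \col_k ((k == i)%:R - (k == j)%:R).

Definition Apert (A : 'M[R]_n) (i j : 'I_n) (t : R) : 'M[R]_n :=
  A + (t * A i j) *: (evec i j *m (evec i j)^T).

Definition Ppert (A : 'M[R]_n) (i j : 'I_n) (t : R) : 'M[R]_n :=
  diag_mx (\row_k (degs A k 0)^-1) *m Apert A i j t.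

End Defs.

(* Main.v *)
Require Import Defs.
From HB Require Import structures.
From mathcomp Require Import all_boot all_order all_algebra.
From mathcomp Require Import all_classical all_reals all_analysis.
From mathcomp Require Import ring.
Import Order.TTheory GRing.Theory Num.Theory.
Import numFieldNormedType.Exports.
Local Open Scope classical_set_scope.
Local Open Scope ring_scope.
Set Implicit Arguments.
Unset Strict Implicit.

(** Write [W = 1^T d] and [M(t) = D - A(t) + d d^T / W]. First passage times can
be read off [M(t)^-1], namely [m_kj = W (n_jj - n_kj)], which gives
[K(P(t)) = tr (M(t)^-1 D) - 1]. Since [M(t) = M - t a_ij v v^T] is a rank-one
update, with [N = M^-1] the Sherman-Morrison formula yields
[K(P(t)) - K(P(0)) = t a_ij (v^T N D N v) / (1 - t a_ij v^T N v)], so that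
[f'(0) = a_ij v^T N D N v >= 0].
With [G = N - 1 1^T / W] one has [N v = G v], as [1^T v = 0], and the Cauchy-Schwarz inequality gives
[v^T N D N v <= (1/d_i + 1/d_j) sum_kl d_k d_l g_kl^2
             = (1/d_i + 1/d_j) (tr ((N D)^2) - 1)].
Finally [N D = (I - (P - 1 pi^T))^-1] has the eigenvalues [1] and
[1 / (1 - lambda_l)]; multiplicities are tracked by comparing characteristic
polynomials at all large real numbers. *)

(** * Determinants and characteristic polynomials under squaring, inversion and deflation *)

Lemma unitmx_ker0 (F : fieldType) (n : nat) (A : 'M[F]_n) :
  (forall x : 'cV_n, A *m x = 0 -> x = 0) -> A \in unitmx.
Proof.
move=> ker0; rewrite -unitmx_tr unitmxE unitfE; apply/det0P => -[v vn0 vA].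
move/negP: vn0; apply; rewrite -trmx_eq0; apply/eqP/ker0.
by rewrite -[A]trmxK -trmx_mul vA trmx0.
Qed.

Lemma tr_delta_mulmx (R : pzSemiRingType) (n : nat) (j : 'I_n) (x : 'cV[R]_n) :
  (delta_mx j 0)^T *m x = (x j 0)%:M.
Proof.
rewrite trmx_delta -rowE; apply/matrixP => k l.
by rewrite (ord1 k) (ord1 l) !mxE mulr1n.
Qed.

(** The difference vanishes at the points [|c| + k + 1], too many for a nonzero polynomial. Hence
    characteristic polynomials need only be compared where the required inverses and square roots
    exist. *)
Lemma poly_eq_large (R : numDomainType) (p q : {poly R}) (c : R) :
  (forall x, c < x -> p.[x] = q.[x]) -> c \is Num.real -> p = q.
Proof.
move=> pq cR; apply/eqP; rewrite -subr_eq0; apply/eqP.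
apply: (@roots_geq_poly_eq0 _ _
  [seq (`|c| + k.+1%:R) | k <- iota 0 (size (p - q))]).
- apply/allP => _ /mapP [k _ ->].
  rewrite rootE hornerD hornerN pq ?subrr //.
  by rewrite (le_lt_trans (real_ler_norm cR)) // ltrDl ltr0Sn.
- rewrite map_inj_uniq ?iota_uniq // => k l /addrI /eqP.
  by rewrite eqr_nat eqSS => /eqP.
- by rewrite size_map size_iota.
Qed.

Lemma horner_char_poly (R : comNzRingType) (n : nat) (C : 'M[R]_n) (x : R) :
  (char_poly C).[x] = \det (x%:M - C).
Proof.
rewrite -[LHS]/(horner_eval x _) /char_poly -det_map_mx; congr (\det _).
apply/matrixP => k l; rewrite !mxE /= /horner_eval hornerD hornerN hornerC.
by rewrite hornerMn hornerX.
Qed.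

Lemma det_scalarB_split (R : comNzRingType) (n : nat) (C : 'M[R]_n)
    (mu : 'I_n -> R) :
  char_poly C = \prod_(l < n) ('X - (mu l)%:P) ->
  forall x, \det (x%:M - C) = \prod_l (x - mu l).
Proof.
move=> Ceq x; rewrite -horner_char_poly Ceq horner_prod.
by apply: eq_bigr => l _; rewrite hornerXsubC.
Qed.

(** The block matrix with rows [(1, -u)] and [(v, 1)] factors in two ways into block triangular
    matrices; compare the determinants. *)
Lemma det_1D_mul (R : comNzRingType) (n : nat) (u : 'cV[R]_n) (v : 'rV[R]_n) :
  \det (1%:M + u *m v) = 1 + (v *m u) 0 0.
Proof.
have e1 : block_mx (1%:M + u *m v) (- u) 0 1%:M *m block_mx 1%:M 0 v 1%:M =
          block_mx 1%:M (- u) v (1%:M : 'M[R]_1).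
  by rewrite mulmx_block !(mulmx1, mulmx0, mul0mx, mul1mx, mulNmx, add0r) addrK.
have e2 : block_mx 1%:M 0 v 1%:M *m block_mx 1%:M (- u) 0 (1%:M + v *m u) =
          block_mx 1%:M (- u) v (1%:M : 'M[R]_1).
  by rewrite mulmx_block !(mulmx1, mulmx0, mul0mx, mul1mx, mulmxN, add0r, addr0)
    addrCA addNr addr0.
move/(congr1 determinant): e1; rewrite -e2 !det_mulmx !det_lblock !det_ublock.
by rewrite !det1 !mulr1 !mul1r det_mx11 !mxE /= => ->.
Qed.

(** Compare the coefficients of degree [n - 1]; for [n = 0] there is none, and both sums are
    empty. *)
Lemma mxtrace_char_poly (R : comNzRingType) (n : nat) (C : 'M[R]_n)
    (mu : 'I_n -> R) :
  char_poly C = \prod_(l < n) ('X - (mu l)%:P) -> \tr C = \sum_l mu l.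
Proof.
case: n C mu => [|n] C mu Ceq; first by rewrite /mxtrace !big_ord0.
apply: oppr_inj; rewrite -char_poly_trace // Ceq.
have := @coefPn_prod_XsubC R [seq mu l | l <- enum 'I_n.+1].
by rewrite !big_map size_map size_enum_ord -!enumT !big_enum; apply.
Qed.

Lemma char_poly_sqr (R : rcfType) (n : nat) (C : 'M[R]_n) (mu : 'I_n -> R) :
  char_poly C = \prod_(l < n) ('X - (mu l)%:P) ->
  char_poly (C *m C) = \prod_(l < n) ('X - (mu l ^+ 2)%:P).
Proof.
move=> Ceq; apply: (@poly_eq_large _ _ _ 0) => // x x0.
have Cx := det_scalarB_split Ceq.
set s := Num.sqrt x; have xE : x = s ^+ 2 by rewrite sqr_sqrtr // ltW.
rewrite horner_char_poly horner_prod.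
(* The factorization [(s - C)(s + C)], with [s + C] written as [-(-s - C)] so that the product
   formula [Cx] applies at [-s]. *)
have -> : x%:M - C *m C = (s%:M - C) *m ((-1) *: ((- s)%:M - C)).
  rewrite scaleN1r opprB raddfN /= opprK mulmxBl !mulmxDr.
  rewrite -scalar_mxM -expr2 -xE -scalar_mxC.
  by rewrite opprD [RHS]addrC addrA addrNK addrC.
rewrite det_mulmx detZ !Cx -[n in (-1) ^+ n]card_ord -prodr_const -!big_split /=.
apply: eq_bigr => l _; rewrite hornerXsubC xE; ring.
Qed.

Lemma char_poly_inv1B (R : realFieldType) (n : nat) (C : 'M[R]_n)
    (nu : 'I_n -> R) :
  1%:M - C \in unitmx ->
  char_poly C = \prod_(l < n) ('X - (nu l)%:P) ->
  char_poly (invmx (1%:M - C)) = \prod_(l < n) ('X - ((1 - nu l)^-1)%:P).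
Proof.
move=> U Ceq; apply: (@poly_eq_large _ _ _ 0) => // x x0.
have Cx := det_scalarB_split Ceq.
have nz l : 1 - nu l != 0.
  move: U; rewrite unitmxE Cx unitfE; apply: contraNneq => nul.
  by rewrite (bigD1 l) //= nul mul0r.
rewrite horner_char_poly horner_prod.
(* Pulling out [(1 - C)^-1] and [x] leaves the characteristic matrix of [C] at [1 - 1/x]. *)
have -> : x%:M - invmx (1%:M - C) =
    invmx (1%:M - C) *m (x *: ((1 - x^-1)%:M - C)).
  apply: (can_inj (mulKmx U)); rewrite mulKVmx // mulmxBr mulmxV //.
  rewrite mul_mx_scalar !scalerBr !scale_scalar_mx mulrBr !mulr1 divff ?gt_eqF //.
  by rewrite raddfB /= addrAC.
rewrite det_mulmx detZ det_inv !Cx -[n in x ^+ n]card_ord -prodr_const.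
rewrite -prodfV -!big_split /=.
apply: eq_bigr => l _; rewrite hornerXsubC; field.
by rewrite nz gt_eqF.
Qed.

(** Since [(x - P) u = (x - 1) u], the matrix [x - (P - u p)] is [x - P] times a rank-one
    perturbation of the identity with determinant [x / (x - 1)]. This factor trades the root 1 for
    the root 0. *)
Lemma char_poly_deflate (R : realFieldType) (n : nat) (P : 'M[R]_n)
    (u : 'cV[R]_n) (p : 'rV[R]_n) (lam : 'I_n -> R) (i0 : 'I_n) :
  P *m u = u -> p *m u = 1%:M ->
  char_poly P = \prod_(l < n) ('X - (lam l)%:P) -> lam i0 = 1 ->
  char_poly (P - u *m p) =
    \prod_(l < n) ('X - (if l == i0 then 0 else lam l)%:P).
Proof.
move=> Pu pu Peq l1; apply: (@poly_eq_large _ _ _ 1) => // x x1.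
have xn1 : x - 1 != 0 by rewrite subr_eq0 gt_eqF.
rewrite horner_char_poly.
have -> : x%:M - (P - u *m p) = (x%:M - P) *m (1%:M + ((x - 1)^-1 *: u) *m p).
  rewrite mulmxDr mulmx1 -scalemxAl -scalemxAr mulmxA mulmxBl Pu mul_scalar_mx.
  have -> : x *: u - u = (x - 1) *: u by rewrite scalerBl scale1r.
  rewrite -scalemxAl scalerA mulVf // scale1r.
  by rewrite opprB addrA addrAC.
rewrite det_mulmx -horner_char_poly Peq det_1D_mul -scalemxAr pu !mxE mulr1n mulr1.
rewrite !horner_prod (bigD1 i0) //= [in RHS](bigD1 i0) //= eqxx !hornerXsubC l1.
rewrite mulrAC; congr (_ * _); first by field.
by apply: eq_bigr => l /negPf ->.
Qed.

(** * First passage times and the Kemeny constant of a walk on a weighted graph *)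

Section Walk.
Variables (R : realType) (n : nat) (d : 'cV[R]_n) (B : 'M[R]_n).

Let o : 'cV[R]_n := const_mx 1.
Definition vol := \sum_k d k 0.
Definition walk : 'M[R]_n := diag_mx (\row_k (d k 0)^-1) *m B.
Definition fund : 'M[R]_n := diag_mx d^T - B + vol^-1 *: (d *m d^T).
Let Dg := diag_mx d^T.

Lemma diag_mx_tr_mul1 : Dg *m o = d.
Proof. by apply/matrixP => k l; rewrite mul_diag_mx !mxE mulr1 (ord1 l). Qed.

Lemma tr_mul1 : d^T *m o = vol%:M.
Proof.
apply/matrixP => k l; rewrite !mxE (ord1 k) (ord1 l) mulr1n.
by apply: eq_bigr => m _; rewrite !mxE mulr1.
Qed.

Hypothesis B_sym : B^T = B.
Hypothesis B1 : B *m o = d.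
Hypothesis d_gt0 : forall k, 0 < d k 0.
Variable k0 : 'I_n.

Lemma vol_gt0 : 0 < vol.
Proof.
rewrite /vol (bigD1 k0) //= ltr_pwDl // sumr_ge0 // => k _; exact: ltW.
Qed.
Let vol_neq0 : vol != 0. Proof. by rewrite gt_eqF // vol_gt0. Qed.
Let d_neq0 k : d k 0 != 0. Proof. by rewrite gt_eqF. Qed.

Lemma tr_fund : fund^T = fund.
Proof.
by rewrite /fund linearD /= linearB /= B_sym tr_diag_mx linearZ /= trmx_mul trmxK.
Qed.

Lemma fund1 : fund *m o = d.
Proof.
rewrite /fund mulmxDl mulmxBl diag_mx_tr_mul1 B1 subrr add0r -scalemxAl.
by rewrite -mulmxA tr_mul1 mul_mx_scalar scalerA mulVf // scale1r.
Qed.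

Lemma diag_walk : Dg *m walk = B.
Proof.
rewrite /walk mulmxA mulmx_diag -[RHS]mul1mx -diag_const_mx.
by congr (diag_mx _ *m _); apply/matrixP => k l; rewrite !mxE mulfV // d_neq0.
Qed.

Lemma diag_degs_unit : Dg \in unitmx.
Proof.
rewrite unitmxE det_diag unitfE; apply/prodf_neq0 => k _.
by rewrite mxE d_neq0.
Qed.

Lemma walk1 : walk *m o = o.
Proof.
apply: (can_inj (mulKmx diag_degs_unit)).
by rewrite mulmxA diag_walk diag_mx_tr_mul1.
Qed.

Hypothesis fund_unit : fund \in unitmx.
Let N := invmx fund.

Lemma invfund_degs : N *m d = o.
Proof. by rewrite -fund1 mulKmx. Qed.

Lemma tr_invfund : N^T = N.
Proof. by rewrite /N trmx_inv tr_fund. Qed.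

Lemma degs_invfund : d^T *m N = o^T.
Proof. by rewrite -tr_invfund -trmx_mul invfund_degs. Qed.

Lemma lap_invfund : (Dg - B) *m N = 1%:M - vol^-1 *: (d *m o^T).
Proof.
have -> : Dg - B = fund - vol^-1 *: (d *m d^T) by rewrite /fund addrK.
by rewrite mulmxBl mulmxV // -scalemxAl -mulmxA degs_invfund.
Qed.

Lemma stat_vec_walk : stat_vec walk = vol^-1 *: d^T.
Proof.
rewrite /stat_vec; apply: xget_unique.
  split; last split.
  - rewrite -scalemxAl; congr (_ *: _); apply: trmx_inj.
    rewrite !trmx_mul B_sym tr_diag_mx -mulmxA trmxK -[RHS]B1; congr (_ *m _).
    apply/matrixP => k l.
    by rewrite mul_diag_mx (ord1 l) mxE [in RHS]mxE mxE mulVf // d_neq0.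
  - by move=> k; rewrite !mxE mulr_ge0 ?invr_ge0 ?(ltW vol_gt0) ?(ltW (d_gt0 k)).
  - under eq_bigr do rewrite mxE.
    rewrite -mulr_sumr; under eq_bigr do rewrite mxE.
    by rewrite mulVf.
move=> p [pQ [_ p1]].
have po : p *m o = 1%:M.
  apply/matrixP => k l; rewrite !mxE (ord1 k) (ord1 l) -[RHS]p1.
  by apply: eq_bigr => m _; rewrite mxE mulr1.
(* Uniqueness: [q = p D^-1] satisfies [q D = q B] and [q d = 1], hence [q fund = d^T / vol], and
   invertibility of [fund] determines [q]. *)
have pE : p = (p *m invmx Dg) *m Dg by rewrite mulmxKV // diag_degs_unit.
set q := p *m invmx Dg in pE.
have qB : q *m B = p by rewrite -diag_walk mulmxA -pE.
have : q *m fund = vol^-1 *: d^T.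
  rewrite /fund mulmxDr mulmxBr -pE qB subrr add0r -scalemxAr mulmxA.
  by rewrite -{1}diag_mx_tr_mul1 mulmxA -pE po mul1mx.
move/(congr1 (mulmx^~ N)); rewrite mulmxK // -scalemxAl degs_invfund => qE.
by rewrite pE qE -scalemxAl -diag_mx_tr_mul1 trmx_mul tr_diag_mx.
Qed.

Let e j : 'cV[R]_n := delta_mx j 0.

Lemma tabooE j : taboo walk j = walk - walk *m (e j *m (e j)^T).
Proof.
move: walk => Q; apply/matrixP => k l.
rewrite mulmxA trmx_delta -colE !mxE big_ord1 !mxE eqxx /=.
by case: eqP => [->|_] /=; rewrite ?mulr1 ?mulr0 ?subrr ?subr0.
Qed.

Lemma diag_taboo j (x : 'cV[R]_n) :
  Dg *m ((1%:M - taboo walk j) *m x) = (Dg - B) *m x + x j 0 *: (B *m e j).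
Proof.
rewrite tabooE opprB mulmxA !mulmxDr mulmx1 mulmxN mulmxA diag_walk mulmxBl.
rewrite !mulmxDl mulNmx -!mulmxA tr_delta_mulmx mul_mx_scalar -scalemxAr.
by rewrite -[RHS]addrA; congr (_ + _); rewrite addrC.
Qed.

(** For [x] in the kernel, pairing [diag_taboo] with 1 removes the Laplacian and leaves
    [x_j d_j = 0]. Then the Laplacian kills [x], so [x] is constant because [fund] is invertible,
    and [x_j = 0] makes it zero. *)
Lemma taboo_unit j : 1%:M - taboo walk j \in unitmx.
Proof.
apply: unitmx_ker0 => x Tx.
have := diag_taboo j x; rewrite Tx mulmx0 => /esym xE.
have BoT : o^T *m B = d^T by rewrite -[B]B_sym -trmx_mul B1.
have lap0 : o^T *m (Dg - B) = 0.
  by rewrite mulmxBr BoT -[Dg]tr_diag_mx -trmx_mul diag_mx_tr_mul1 subrr.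
have xj0 : x j 0 = 0.
  have := congr1 (mulmx o^T) xE.
  rewrite mulmx0 mulmxDr mulmxA lap0 mul0mx add0r -scalemxAr mulmxA BoT.
  rewrite -colE => /matrixP/(_ 0 0); rewrite !mxE => /eqP.
  by rewrite mulf_eq0 (negPf (d_neq0 j)) orbF => /eqP.
move: xE; rewrite xj0 scale0r addr0 => lx0.
have fx : fund *m x = (vol^-1 * (d^T *m x) 0 0) *: d.
  rewrite /fund mulmxDl lx0 add0r -scalemxAl -mulmxA {1}[d^T *m x]mx11_scalar.
  by rewrite mul_mx_scalar scalerA.
have xo : x = (vol^-1 * (d^T *m x) 0 0) *: o.
  by rewrite -{1}[x](mulKmx fund_unit) fx -scalemxAr invfund_degs.
have : x j 0 = vol^-1 * (d^T *m x) 0 0 by rewrite {1}xo !mxE mulr1.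
by rewrite xj0 => c0; rewrite xo -c0 scale0r.
Qed.

Lemma mfpt_walk k j : mfpt walk k j = vol * (N j j - N k j).
Proof.
rewrite /mfpt; case: eqP => [->|/eqP kj]; first by rewrite subrr mulr0.
(* The [j]-th entry of the solution of [m = 1 + Q_taboo m] is the mean return
   time [vol / d_j]. *)
pose m := (vol * N j j) *: o - vol *: (N *m e j) + (vol / d j 0) *: e j.
have mj : m j 0 = vol / d j 0.
  by rewrite /m -colE !mxE eqxx mulr1 subrr add0r mulr1.
(* The Laplacian sends the three terms of [m] to [0], [d - vol e_j] and
   [vol e_j - (vol / d_j) B e_j]. The taboo correction [m_j B e_j] cancels the last piece, leaving
   [d = D 1]. *)
have Tm : (1%:M - taboo walk j) *m m = o.
  apply: (can_inj (mulKmx diag_degs_unit)).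
  rewrite diag_taboo mj diag_mx_tr_mul1 /m mulmxDr mulmxBr -!scalemxAr.
  have -> : (Dg - B) *m o = 0 by rewrite mulmxBl diag_mx_tr_mul1 B1 subrr.
  rewrite mulmxA lap_invfund scaler0 add0r !mulmxBl mul1mx -scalemxAl -mulmxA.
  have -> : o^T *m e j = 1%:M.
    by apply/matrixP => a b; rewrite -colE (ord1 a) (ord1 b) !mxE.
  have De : Dg *m e j = d j 0 *: e j.
    apply/matrixP => a b; rewrite mul_diag_mx !mxE.
    by case: eqP => [->|_]; rewrite ?mulr0.
  rewrite mulmx1 scalerBr scalerA mulfV // scale1r De scalerBr scalerA.
  rewrite -[_ / _ * _]mulrA mulVf // mulr1 addrA subrK.
  by rewrite opprB subrK.
rewrite -[const_mx 1]/o -Tm mulKmx ?taboo_unit // /m -colE !mxE (negPf kj) /=.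
by rewrite mulr0 addr0 mulr1 mulrBr.
Qed.

Lemma kemeny_walk : kemeny k0 walk = \tr (N *m Dg) - 1.
Proof.
rewrite /kemeny stat_vec_walk.
(* Writing 1 as [sum_j n_(k0,j) d_j] makes the identity hold term by term in [j]. *)
have -> : 1 = (N *m d) k0 0 by rewrite invfund_degs mxE.
rewrite mul_mx_diag /mxtrace !mxE -sumrB; apply: eq_bigr => j _.
rewrite mfpt_walk !mxE; field.
exact: vol_neq0.
Qed.

End Walk.

(** * Connectedness makes [fund] invertible *)

Lemma harmonic_connected_const (R : realType) (n : nat) (A : 'M[R]_n)
    (x : 'I_n -> R) :
  A^T = A -> (forall k l, 0 <= A k l) -> connected_graph A ->
  (forall k, \sum_l A k l * (x k - x l) = 0) -> forall k l, x k = x l.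
Proof.
move=> A_sym A_ge0 A_conn xh.
have As k l : A k l = A l k by rewrite -[in LHS]A_sym mxE.
pose F1 k l := A k l * (x k - x l) * x k.
pose F2 k l := A k l * (x k - x l) * x l.
(* Harmonicity kills [F1] when summed over [l] first; by symmetry of [A] it kills [F2] when summed
   over [k] first. *)
have s1 : \sum_k \sum_l F1 k l = 0.
  by rewrite big1 // => k _; rewrite -mulr_suml xh mul0r.
have s2 : \sum_k \sum_l F2 k l = 0.
  rewrite exchange_big big1 //= => l _; rewrite -mulr_suml.
  under eq_bigr => k _ do rewrite As -opprB mulrN.
  by rewrite sumrN xh oppr0 mul0r.
(* [F1 - F2] sums to the Dirichlet energy of [x]. *)
have s3 : \sum_k \sum_l A k l * (x k - x l) ^+ 2 = 0.
  rewrite -[RHS](subrr (\sum_k \sum_l F1 k l)) [X in _ - X]s1 -[X in _ - X]s2.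
  rewrite -sumrB; apply: eq_bigr => k _; rewrite -sumrB.
  by apply: eq_bigr => l _; rewrite /F1 /F2; ring.
have edge k l : adj A k l -> x k = x l.
  move=> Akl; have ge0 a b : 0 <= A a b * (x a - x b) ^+ 2.
    by rewrite mulr_ge0 // sqr_ge0.
  have := psumr_eq0P (fun a _ => sumr_ge0 _ (fun b _ => ge0 a b)) s3.
  move/(_ k isT)/(psumr_eq0P (fun b _ => ge0 k b))/(_ l isT)/eqP.
  by rewrite mulf_eq0 gt_eqF //= sqrf_eq0 subr_eq0 => /eqP.
move=> k l; have /connectP [p] := A_conn k l.
elim: p k => [|m p IH] k /=; first by move=> _ ->.
by case/andP => /edge -> /IH H /H.
Qed.

(** As [1^T fund = d^T], a kernel vector [x] has [d^T x = 0]. So the Laplacian kills [x], which is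
    then constant by connectedness, and [d^T x = 0] with positive volume makes the constant zero. *)
Lemma fund_unit_connected (R : realType) (n : nat) (A : 'M[R]_n) (k0 : 'I_n) :
  A^T = A -> (forall k l, 0 <= A k l) -> (forall k, 0 < degs A k 0) ->
  connected_graph A -> fund (degs A) A \in unitmx.
Proof.
move=> A_sym A_ge0 d_gt0 A_conn.
have vol0 : vol (degs A) != 0 by rewrite gt_eqF // vol_gt0.
apply: unitmx_ker0 => x fx.
have dx : (degs A)^T *m x = 0.
  rewrite -(@fund1 _ _ (degs A) A (erefl _) d_gt0 k0) trmx_mul.
  by rewrite tr_fund // -mulmxA fx mulmx0.
have lx : (diag_mx (degs A)^T - A) *m x = 0.
  by move: fx; rewrite /fund mulmxDl -scalemxAl -mulmxA dx mulmx0 scaler0 addr0.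
have xc := @harmonic_connected_const _ _ _ (x^~ 0) A_sym A_ge0 A_conn.
have {}xc k l : x k 0 = x l 0.
  apply: xc => {}k.
  have /matrixP/(_ k 0) := lx; rewrite mulmxBl mul_diag_mx !mxE => lxk.
  rewrite -[RHS]lxk mulr_suml -sumrB; apply: eq_bigr => m _.
  by rewrite mxE mulr1 mulrBr.
have xE : x = x k0 0 *: const_mx 1.
  by apply/matrixP => k l; rewrite !mxE mulr1 (ord1 l) (xc k k0).
move: dx; rewrite xE -scalemxAr tr_mul1 scale_scalar_mx => /matrixP/(_ 0 0).
rewrite !mxE mulr1n => /eqP; rewrite mulf_eq0 (negPf vol0) orbF => /eqP ->.
by rewrite scale0r.
Qed.

(** * Rank-one perturbation, and the spectral bound on the derivative *)

Lemma invmx_rank1_update (F : fieldType) (n : nat) (M : 'M[F]_n)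
    (u : 'cV[F]_n) (w : 'rV[F]_n) (c := 1 - (w *m invmx M *m u) 0 0) :
  M \in unitmx -> c != 0 ->
  M - u *m w \in unitmx /\
  invmx (M - u *m w) = invmx M + c^-1 *: (invmx M *m u *m w *m invmx M).
Proof.
move=> MU c0; set N := invmx M.
have H : (M - u *m w) *m (N + c^-1 *: (N *m u *m w *m N)) = 1%:M.
  rewrite mulmxDr mulmxBl mulmxV // -scalemxAr mulmxBl !mulmxA mulmxV // mul1mx.
  (* Isolate the scalar [w N u = 1 - c]: the total coefficient of [u w N] becomes
     [-1 + c^-1 (1 - (1 - c)) = 0]. *)
  rewrite -[u *m w *m N *m u]mulmxA -[u *m w *m (N *m u)]mulmxA [w *m _]mulmxA.
  rewrite [w *m N *m u]mx11_scalar mul_mx_scalar -!scalemxAl.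
  rewrite -{2}[u *m w *m N]scale1r -scalerBl -/c scalerA mulVf // scale1r.
  by rewrite subrK.
have [U _] := mulmx1_unit H; split => //.
by rewrite -[RHS](mulKmx U) H mulmx1.
Qed.

Lemma diag_quadE (R : comNzRingType) (n : nat) (d y : 'cV[R]_n) :
  (y^T *m diag_mx d^T *m y) 0 0 = \sum_k d k 0 * y k 0 ^+ 2.
Proof.
by rewrite mul_mx_diag mxE; apply: eq_bigr => k _; rewrite !mxE; ring.
Qed.

Section Perturbation.
Variables (R : realType) (n : nat) (A : 'M[R]_n) (d : 'cV[R]_n) (i j : 'I_n).
Hypothesis A_sym : A^T = A.
Hypothesis dE : degs A = d.
Hypothesis d_gt0 : forall k, 0 < d k 0.
Let Dg := diag_mx d^T.
Hypothesis fund_unit : fund d A \in unitmx.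
Let N := invmx (fund d A).
Let v := evec R i j.

Lemma tr_Apert t : (Apert A i j t)^T = Apert A i j t.
Proof. by rewrite /Apert linearD /= A_sym linearZ /= trmx_mul trmxK. Qed.

Lemma degs_Apert t : Apert A i j t *m const_mx 1 = d.
Proof.
rewrite /Apert mulmxDl -scalemxAl -mulmxA.
suff -> : (evec R i j)^T *m (const_mx 1 : 'cV_n) = 0.
  by rewrite mulmx0 scaler0 addr0 -dE.
apply/matrixP => a b; rewrite !mxE; under eq_bigr do rewrite !mxE mulr1.
rewrite sumrB -!natr_sum (bigD1 i) //= [in X in _ - X](bigD1 j) //= !eqxx.
by rewrite !big1 ?subrr // => k /negPf ->.
Qed.

Lemma kemeny_Apert t (r := (v^T *m N *m v) 0 0)
    (q := (v^T *m N *m Dg *m N *m v) 0 0) :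
  1 - t * A i j * r != 0 ->
  kemeny i (Ppert A i j t) =
    \tr (N *m Dg) - 1 + t * A i j * q / (1 - t * A i j * r).
Proof.
move=> c0; set s := t * A i j in c0 *.
have fE : fund d (Apert A i j t) = fund d A - (s *: v) *m v^T.
  by rewrite /fund /Apert -/s -/v -scalemxAl opprD addrA [RHS]addrAC.
have cE : 1 - (v^T *m N *m (s *: v)) 0 0 = 1 - s * r by rewrite -scalemxAr mxE.
have := @invmx_rank1_update _ _ _ (s *: v) v^T fund_unit.
rewrite -/N cE -fE => /(_ c0) [U NE].
have -> : Ppert A i j t = walk d (Apert A i j t) by rewrite /walk -dE.
rewrite (kemeny_walk (tr_Apert t) (degs_Apert t) d_gt0 i U) NE.
rewrite mulmxDl mxtraceD addrAC; congr (_ + _).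
rewrite -scalemxAl mxtraceZ -scalemxAr -!scalemxAl mxtraceZ.
have -> : \tr (N *m v *m v^T *m N *m Dg) = q.
  by rewrite -!mulmxA [N *m (v *m _)]mulmxA mxtrace_mulC trace_mx11 /q -!mulmxA.
by rewrite mulrC.
Qed.

Lemma evec_quadE : (v^T *m N *m Dg *m N *m v) 0 0 =
  \sum_k d k 0 * (N k i - N k j) ^+ 2.
Proof.
have Nv : N *m v = \col_k (N k i - N k j).
  apply/matrixP => k l; rewrite !mxE; under eq_bigr do rewrite mxE mulrBr.
  rewrite sumrB (bigD1 i) //= [in X in _ - X](bigD1 j) //= !eqxx !mulr1.
  by rewrite !big1 ?addr0 // => m /negPf ->; rewrite mulr0.
have NT : N^T = N by apply: tr_invfund.
rewrite -mulmxA Nv -{1}NT -trmx_mul Nv diag_quadE.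
by apply: eq_bigr => k _; rewrite mxE.
Qed.

Lemma evec_quad_le : i != j ->
  (v^T *m N *m Dg *m N *m v) 0 0 <=
  ((d i 0)^-1 + (d j 0)^-1) * (\tr (N *m Dg *m (N *m Dg)) - 1).
Proof.
move=> ij; pose W := vol d; pose G k l := N k l - W^-1.
have W0 : W != 0 by rewrite gt_eqF // (vol_gt0 _ i).
have NT' : N^T = N by apply: tr_invfund.
have NT k l : N k l = N l k by rewrite -[in LHS]NT' mxE.
have NDE k l : (N *m Dg) k l = N k l * d l 0 by rewrite mul_mx_diag !mxE.
have Nd k : \sum_l N k l * d l 0 = 1.
  have /matrixP/(_ k 0) := invfund_degs dE d_gt0 i fund_unit.
  by rewrite -/N mxE => ->; rewrite mxE.
have -> : \tr (N *m Dg *m (N *m Dg)) - 1 =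
    \sum_k \sum_l d k 0 * d l 0 * G k l ^+ 2.
  have GE k : \sum_l d k 0 * d l 0 * G k l ^+ 2 =
      (N *m Dg *m (N *m Dg)) k k - W^-1 * d k 0.
    (* The correction terms from expanding the square in [G]; by [N d = 1] they sum to
       [2 d_k / W - d_k / W]. *)
    have -> : W^-1 * d k 0 =
        \sum_l (2 * W^-1 * d k 0 * (N k l * d l 0) - W^-1 ^+ 2 * d k 0 * d l 0).
      rewrite sumrB -!mulr_sumr Nd -[\sum_l d l 0]/W; field.
      exact: W0.
    rewrite mxE -sumrB; apply: eq_bigr => l _.
    by rewrite !NDE /G [N l k]NT; ring.
  rewrite (eq_bigr _ (fun k _ => GE k)) sumrB -mulr_sumr -[\sum_l d l 0]/W.
  by rewrite mulVf.
rewrite evec_quadE mulr_sumr; apply: ler_sum => k _.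
(* Only the columns [i] and [j] of the nonnegative sum are kept. *)
have two_terms : d k 0 * (d i 0 * G k i ^+ 2 + d j 0 * G k j ^+ 2) <=
    \sum_l d k 0 * d l 0 * G k l ^+ 2.
  rewrite (bigD1 i) //= (bigD1 j) 1?eq_sym //= addrA mulrDr !mulrA lerDl.
  by rewrite sumr_ge0 // => l _; rewrite mulr_ge0 ?sqr_ge0 // mulr_ge0 ?ltW.
have -> : N k i - N k j = G k i - G k j by rewrite /G opprB addrA subrK.
have di := d_gt0 i; have dj := d_gt0 j.
apply: le_trans (ler_wpM2l _ two_terms); last first.
  by rewrite addr_ge0 // invr_ge0 ltW.
rewrite [X in _ <= X]mulrCA ler_wpM2l ?(ltW (d_gt0 k)) // -subr_ge0.
(* The defect in the two-term Cauchy-Schwarz inequality is an explicit square. *)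
have -> : ((d i 0)^-1 + (d j 0)^-1) * (d i 0 * G k i ^+ 2 + d j 0 * G k j ^+ 2) -
    (G k i - G k j) ^+ 2 =
    (d i 0 * d j 0)^-1 * (d i 0 * G k i + d j 0 * G k j) ^+ 2.
  by field; rewrite !gt_eqF.
by rewrite mulr_ge0 ?sqr_ge0 // invr_ge0 mulr_ge0 // ltW.
Qed.

Lemma mxtrace_fund_sqr (lam : 'I_n -> R) (i0 : 'I_n) :
  char_poly (walk d A) = \prod_(l < n) ('X - (lam l)%:P) -> lam i0 = 1 ->
  \tr (N *m Dg *m (N *m Dg)) - 1 = \sum_(l < n | l != i0) ((1 - lam l) ^+ 2)^-1.
Proof.
move=> Peq l1; pose C := walk d A - const_mx 1 *m ((vol d)^-1 *: d^T).
have DC : Dg *m (1%:M - C) = fund d A.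
  rewrite /C opprB mulmxDr mulmxBr mulmx1 diag_walk // mulmxA.
  by rewrite diag_mx_tr_mul1 -scalemxAr [RHS]addrAC addrA.
have CN : N *m Dg *m (1%:M - C) = 1%:M by rewrite -mulmxA DC mulVmx.
have [_ CU] := mulmx1_unit CN.
have NE : invmx (1%:M - C) = N *m Dg.
  by rewrite -[RHS](mulmxK CU) CN mul1mx.
have W0 : vol d != 0 by rewrite gt_eqF // (vol_gt0 _ i).
have pu : (vol d)^-1 *: d^T *m const_mx 1 = 1%:M :> 'M[R]_1.
  by rewrite -scalemxAl tr_mul1 scale_scalar_mx mulVf.
(* Deflation sets the eigenvalue at [i0] to 0, so inverting [1 - C] and squaring gives 1 there; this
   is the 1 subtracted from the trace. *)
have := char_poly_deflate (walk1 dE d_gt0) pu Peq l1.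
move/(char_poly_inv1B CU)/char_poly_sqr/mxtrace_char_poly.
rewrite NE => ->; rewrite (bigD1 i0) //= eqxx subr0 invr1 expr1n addrAC subrr add0r.
by apply: eq_bigr => l /negPf ->; rewrite exprVn.
Qed.

End Perturbation.

(** * The right derivative at 0 and its two bounds *)

Theorem theorem8 (R : realType) (n : nat) (A : 'M[R]_n) (i j : 'I_n) :
  A^T = A ->
  (forall k l, 0 <= A k l) ->
  (forall k, 0 < degs A k 0) ->
  connected_graph A ->
  i != j ->
  0 < A i j ->
  ~ is_cut_edge A i j ->
  let f := fun t : R => kemeny i (Ppert A i j t) in
  exists L : R,
    (fun h : R => h^-1 * (f h - f 0)) @ 0^'+ --> L /\
    0 <= L /\
    forall (lam : 'I_n -> R) (i0 : 'I_n),
      char_poly (Ppert A i j 0) = \prod_(l < n) ('X - (lam l)%:P) ->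
      lam i0 = 1 ->
      L <= A i j * ((degs A i 0)^-1 + (degs A j 0)^-1) *
             \sum_(l < n | l != i0) ((1 - lam l) ^+ 2)^-1.
Proof.
move=> A_sym A_ge0 d_gt0 A_conn ij a_gt0 _ f.
have U := fund_unit_connected i A_sym A_ge0 d_gt0 A_conn.
set N := invmx (fund (degs A) A); pose v := evec R i j.
pose q := (v^T *m N *m diag_mx (degs A)^T *m N *m v) 0 0.
pose r := (v^T *m N *m v) 0 0.
exists (A i j * q); split; last split.
- have c1 : (fun h => 1 - h * A i j * r) @ (0 : R)^'+ --> (1 : R).
    apply: cvg_at_right_filter; rewrite -[X in _ --> X](subr0 1).
    apply: cvgB; first exact: cvg_cst.
    have e0 : 0 = 0 * A i j * r :> R by rewrite !mul0r.
    rewrite [X in _ --> X]e0.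
    by apply: cvgMl; apply: cvgMl; apply: cvg_id.
  have c2 : (fun h => A i j * q * (1 - h * A i j * r)^-1) @ (0 : R)^'+
      --> A i j * q.
    have e1 : A i j * q = A i j * q * 1^-1 by rewrite invr1 mulr1.
    rewrite [X in _ --> X]e1.
    by apply: cvgMr; apply: cvgV => //; rewrite oner_neq0.
  (* For small [h > 0] the denominator is near 1, hence nonzero, and the closed form of [f] makes
     the difference quotient equal to [a_ij q / (1 - h a_ij r)]. *)
  apply: cvg_trans c2; apply: near_eq_cvg; near=> h.
  have h0 : h != 0 by rewrite gt_eqF //; near: h; exact: nbhs_right_gt.
  have c0 : 1 - h * A i j * r != 0.
    by near: h; apply: (cvgr_neq0 _ c1); rewrite oner_neq0.
  rewrite /f !(kemeny_Apert A_sym (erefl _) d_gt0 U) //.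
    rewrite -/N -/v -/r -/q !mul0r addr0 addrAC subrr add0r; field.
    by rewrite c0 h0.
  by rewrite !mul0r subr0 oner_neq0.
- apply: mulr_ge0; first exact: ltW.
  rewrite /q evec_quadE //.
  apply: sumr_ge0 => k _; by rewrite mulr_ge0 ?sqr_ge0 ?ltW.
- move=> lam i0 Peq l1; rewrite -mulrA ler_pM2l //.
  rewrite -(mxtrace_fund_sqr i (erefl _) d_gt0 U _ l1).
    exact: evec_quad_le.
  by move: Peq; rewrite /Ppert /Apert mul0r scale0r addr0.
Unshelve. all: by end_near.
Qed.
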